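(* Consider the switching time optimization problem for the grid-linearized switched system, with cost function $$J(\delta)=\int_0^{T_\delta} x(t)^\top Q x(t)\,\mathrm{d}t + x(T_\delta)^\top E x(T_\delta)$$ subject to $\dot x(t)=A_i^j x(t)$ for $t\in[\tau_i^j,\tau_i^{j+1})$, $j=0,\dots,n_i$, $i=0,\dots,N$, and $x(0)=x_0$, where $\delta=(\delta_0,\dots,\delta_N)$ are the switching intervals (all notation as in the context). The following holds: (i) The cost function $J(\delta)$ is the following quadratic function of the initial state: $$J(\delta)=x_0^\top S_0 x_0 .$$ (ii) The gradient $\nabla J(\delta)$ of the cost function can be computed as $$\nabla J(\delta)_i=\frac{\partial J(\delta)}{\partial\delta_i}=x_{i+1}^\top C_i x_{i+1},\qquad i=0,\dots,N .$$ (iii) The Hessian $H_J(\delta)$ of the cost function can be computed as $$H_J(\delta)_{i,\ell}=\frac{\partial^2 J(\delta)}{\partial\delta_i\,\partial\delta_\ell}=\begin{cases}2\,x_{\ell+1}^\top C_\ell\,\Phi(\tau_{\ell+1},\tau_{i+1})\,A_i^{n_i}x_{i+1}, & \ell\ge i,\\ H_J(\delta)_{\ell,i}, & \ell<i,\end{cases}$$ where $i,\ell=0,\dots,N$.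
   Context: **Switching intervals and grid.** The switching times are $\tau_0=0$ and $\tau_1\le\dots\le\tau_{N+1}$, and the switching intervals are $\delta_i=\tau_{i+1}-\tau_i\ge 0$, $i=0,\dots,N$, so that $\tau_i=\sum_{k=0}^{i-1}\delta_k$. The final time is $T_\delta=\tau_{N+1}=\sum_{i=0}^N\delta_i$. In the optimization problem, $\delta$ is constrained to the set of nonnegative vectors with $T_\delta=T$, for a desired final time $T$, and $0\le\underline b_i\le\delta_i\le\bar b_i$ for given bounds $\underline b_i,\bar b_i$ (possibly $\underline b_i=0$, $\bar b_i=\infty$). A background grid of equally spaced time points from $0$ to $T$ is held fixed regardless of the choice of the switching times. Let $n_i$ be the number of background grid points falling between $\tau_i$ and $\tau_{i+1}$ (itself a function of the switching times; $n_{N+1}=0$), and let $\tau_i^j$ be the $j$-th grid point after $\tau_i$. Put $\tau_i^0=\tau_i$, $\tau_i^{n_i+1}=\tau_{i+1}$, and $\delta_i^j=\tau_i^{j+1}-\tau_i^j$, so that $\delta_i=\sum_{j=0}^{n_i}\delta_i^j$. **Linearized dynamics.** The original switched system is $\dot x(t)=f_i(x(t))$ for $t\in[\tau_i,\tau_{i+1})$, $i=0,\dots,N$, with each $f_i:\mathbb{R}^{n_x}\to\mathbb{R}^{n_x}$ differentiable and a fixed initial state. With $x_i^j=x(\tau_i^j)$ and $J_{f_i}$ the Jacobian of $f_i$, the dynamics are linearized around $x_i^j$ and the state is augmented by a constant component, $(x(t),1)^\top$, again denoted $x(t)$; this gives $\dot x(t)=A_i^jx(t)$ for $t\in[\tau_i^j,\tau_i^{j+1})$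 with $$A_i^j=\begin{bmatrix}J_{f_i}(x_i^j)& f_i(x_i^j)-J_{f_i}(x_i^j)x_i^j\\0&0\end{bmatrix},$$ where inside this formula $x_i^j$ is the non-augmented state. Everywhere else states, including $x_0$, are augmented. The augmented weights are $Q=\mathrm{blkdiag}(\bar Q,0)$ and $E=\mathrm{blkdiag}(\bar E,0)$, with $\bar Q,\bar E$ symmetric positive semidefinite $n_x\times n_x$ matrices. Write $x_i=x(\tau_i)$ for $i=0,\dots,N+1$. **State transition matrix.** $\Phi(t,\tau_i^j)$ is the state transition matrix of the linearized system from $\tau_i^j$ to $t\ge\tau_i^j$, so that $x(t)=\Phi(t,\tau_i^j)x_i^j$: $$\Phi(t,\tau_i^j)=e^{A_l^m(t-\tau_l^m)}\prod_{p=0}^{m-1}e^{A_l^p\delta_l^p}\prod_{q=i+1}^{l-1}\prod_{p=0}^{n_q}e^{A_q^p\delta_q^p}\prod_{p=j}^{n_i}e^{A_i^p\delta_i^p},$$ where $\tau_l$ and $\tau_l^m$ are the last switching time and the last grid point before $t$, respectively, and factors belonging to later times stand to the left. Between switching times $\tau_i\le\tau_l$ this is $\Phi(\tau_l,\tau_i)=\prod_{q=i}^{l-1}\prod_{p=0}^{n_q}e^{A_q^p\delta_q^p}$, and $\Phi(\tau_i,\tau_i)=I$. **Cost-to-go matrices.** For $i=0,\dots,N+1$, $S_i=P_i+F_i$ with $$P_i=\int_{\tau_i}^{T_\delta}\Phi(t,\tau_i)^\top Q\,\Phi(t,\tau_i)\,\mathrm{d}t,\qquad F_i=\Phi(T_\delta,\tau_i)^\top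 E\,\Phi(T_\delta,\tau_i).$$ For $i=0,\dots,N$, $$C_i=Q+(A_i^{n_i})^\top S_{i+1}+S_{i+1}A_i^{n_i}.$$
   Formalization: The derivatives in (ii)-(iii) are taken with the matrices A_i^j and the numbers n_i frozen at δ: a change of δ_i alters only δ_i^{n_i} and translates all later grid points in time; with the grid fixed and A_i^j recomputed, the formulas fail. *)

(* Defs.v *)
From HB Require Import structures.
From mathcomp Require Import all_boot all_order all_algebra.
From mathcomp Require Import all_classical all_reals all_analysis.

Set Implicit Arguments.
Unset Strict Implicit.
Unset Printing Implicit Defensive.

Import Order.TTheory GRing.Theory Num.Theory.
Import numFieldNormedType.Exports.

Local Open Scope classical_set_scope.
Local Open Scope ring_scope.

Section Algebra.
Variable R : realType.

Definition qform n (M : 'M[R]_n) (v : 'cV[R]_n) : R := (v^T *m M *m v) 0 0.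

Definition sym_psd n (M : 'M[R]_n) : Prop :=
  M^T = M /\ forall v : 'cV[R]_n, 0 <= qform M v.

Definition expmx n (M : 'M[R]_n) : 'M[R]_n :=
  limn (series (fun k : nat => (k`!%:R)^-1 *: M ^+ k)).

(* F (b - 1) * ... * F (a + 1) * F a : later factors stand to the left. *)
Definition lprod n (a b : nat) (F : nat -> 'M[R]_n) : 'M[R]_n :=
  \prod_(k <- rev (index_iota a b)) F k.

(* Entrywise Lebesgue integral over [a, b]. *)
Definition mxint m n (a b : R) (F : R -> 'M[R]_(m, n)) : 'M[R]_(m, n) :=
  \matrix_(k, l) (\int[lebesgue_measure]_(t in `[a, b]) F t k l)%R.

(* The Jacobian acting on column vectors (the library's ['J] is for rows). *)
Definition cjacobian n (f : 'cV[R]_n -> 'cV[R]_n) (p : 'cV[R]_n) : 'M[R]_n :=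
  \matrix_(k, l) ('D_(delta_mx l 0) f p) k 0.

Definition augment n (v : 'cV[R]_n) : 'cV[R]_(n + 1) := col_mx v 1.

Definition augment_weight n (M : 'M[R]_n) : 'M[R]_(n + 1) := block_mx M 0 0 0.

(* Matrix, on augmented states, of the affine approximation of f at p, where p
   itself is not augmented. *)
Definition linearize n (f : 'cV[R]_n -> 'cV[R]_n) (p : 'cV[R]_n) :
  'M[R]_(n + 1) := block_mx (cjacobian f p) (f p - cjacobian f p *m p) 0 0.

(* l is the partial derivative at d, in the i-th coordinate, of F restricted to
   D: two-sided when d is interior to D in that direction, one-sided at the
   boundary of D (e.g. at a vanishing switching interval). *)
Definition is_partial n (D : set 'rV[R]_n) (F : 'rV[R]_n -> R)
    (d : 'rV[R]_n) (i : 'I_n) (l : R) : Prop :=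
  (fun h : R => h^-1 * (F (d + h *: delta_mx 0 i) - F d))
    @ within [set h : R | D (d + h *: delta_mx 0 i)] (0 : R)^' --> l.

(* h is the second partial derivative d/d_i (d/d_j F) at d. *)
Definition is_partial2 n (D : set 'rV[R]_n) (F : 'rV[R]_n -> R)
    (d : 'rV[R]_n) (i j : 'I_n) (h : R) : Prop :=
  exists2 G : 'rV[R]_n -> R,
    forall d', D d' -> is_partial D F d' j (G d') & is_partial D G d i h.

End Algebra.

Section Times.
Variables (R : realType) (N : nat).
Implicit Types (g : seq R) (delta d : 'rV[R]_N.+1).

(* The M + 1 equally spaced points 0, T / M, 2 T / M, ..., T. *)
Definition equigrid (T : R) (M : nat) : seq R :=
  [seq k%:R * (T / M%:R) | k <- iota 0 M.+1].

(* tau_i, for i = 0, ..., N + 1. *)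
Definition tau d (i : nat) : R := \sum_(k < N.+1 | (k < i)%N) d 0 k.

Definition final_time d : R := tau d N.+1.

(* The points of the increasing list g lying strictly between tau_i and
   tau_(i+1). *)
Definition inner g d (i : nat) : seq R := [seq s <- g | tau d i < s < tau d i.+1].

(* n_i *)
Definition ngrid g d (i : nat) : nat := size (inner g d i).

(* tau_i^j, with tau_i^0 = tau_i and tau_i^(n_i + 1) = tau_(i+1). *)
Definition gtime g d (i j : nat) : R := nth (tau d i.+1) (tau d i :: inner g d i) j.

(* delta_i^j *)
Definition gstep g d (i j : nat) : R := gtime g d i j.+1 - gtime g d i j.

(* Derivatives of the cost at delta are those of the problem in which the
   linearized modes A_i^j and their number n_i + 1 on each switching interval
   are the ones obtained at delta, and in which delta_i^0, ..., delta_i^(n_i-1)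
   keep their values: a change of delta_i to d_i is absorbed by the last
   sub-interval delta_i^(n_i), and everything after tau_(i+1) is translated in
   time.  [node g delta d i j] is tau_i^j for the switching intervals d in that
   problem; by [node_id] it is the genuine tau_i^j when d = delta. *)
Definition node g delta d (i j : nat) : R :=
  if (j <= ngrid g delta i)%N then tau d i + (gtime g delta i j - tau delta i)
  else tau d i.+1.

(* The last sub-intervals must remain of nonnegative length.  In particular
   d_i >= 0, and d_i may vary in a neighborhood of delta_i if delta_i > 0. *)
Definition admissible g delta : set 'rV[R]_N.+1 :=
  [set d | forall i : 'I_N.+1,
     gtime g delta i (ngrid g delta i) - tau delta i <= d 0 i].

Lemma node_id g d (i j : nat) : node g d d i j = gtime g d i j.
Proof.
rewrite /node; case: leqP => [_|ltnj]; first by rewrite addrC subrK.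
by rewrite /gtime nth_default.
Qed.

Lemma tauS d (i : 'I_N.+1) : tau d i.+1 = tau d i + d 0 i.
Proof.
rewrite /tau (bigD1 i) ?ltnS//= addrC; congr (_ + _).
by apply: eq_bigl => k; rewrite ltnS ltn_neqAle andbC.
Qed.

Lemma admissible_id g d : (forall i, 0 <= d 0 i) -> admissible g d d.
Proof.
move=> d_ge0 i; rewrite lerBlDl -tauS /gtime /ngrid.
case Ei: (size (inner g d i)) => [|n] /=.
  by rewrite tauS lerDl.
have: nth (tau d i.+1) (inner g d i) n \in inner g d i.
  by apply: mem_nth; rewrite Ei.
by rewrite mem_filter => /andP[/andP[_ /ltW]].
Qed.

End Times.

Section Dynamics.
Variables (R : realType) (N nx : nat).
Variable g : seq R.
Implicit Types (delta d : 'rV[R]_N.+1).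

(* A_i^j for the trajectory x; only the values i <= N are meaningful. *)
Definition modes (f : 'I_N.+1 -> 'cV[R]_nx -> 'cV[R]_nx) delta
    (x : R -> 'cV[R]_(nx + 1)) (i j : nat) : 'M[R]_(nx + 1) :=
  linearize (f (inord i)) (usubmx (x (gtime g delta i j))).

(* x(0) = z0 and x' = A_i^j x on [tau_i^j, tau_i^(j+1)).  Trajectories are
   continuous, and their derivative may jump at the endpoints of the pieces. *)
Definition is_trajectory (A : nat -> nat -> 'M[R]_(nx + 1)) delta d
    (z0 : 'cV[R]_(nx + 1)) (x : R -> 'cV[R]_(nx + 1)) : Prop :=
  [/\ x 0 = z0,
      {within `[0, final_time d], continuous x} &
      forall (i : 'I_N.+1) (j : nat) (t : R), (j <= ngrid g delta i)%N ->
        node g delta d i j < t < node g delta d i j.+1 ->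
        is_derive t 1 x (A i j *m x t)].

Definition cost (Q E : 'M[R]_(nx + 1)) d (x : R -> 'cV[R]_(nx + 1)) : R :=
  (\int[lebesgue_measure]_(t in `[0%R, final_time d]) qform Q (x t))%R
  + qform E (x (final_time d)).

Variables (A : nat -> nat -> 'M[R]_(nx + 1)) (delta : 'rV[R]_N.+1).

Definition step_exp (q p : nat) : 'M[R]_(nx + 1) :=
  expmx (gstep g delta q p *: A q p).

(* Phi(tau_l, tau_i) *)
Definition Phi_sw (l i : nat) : 'M[R]_(nx + 1) :=
  lprod i l (fun q => lprod 0 (ngrid g delta q).+1 (step_exp q)).

(* Indices of the last switching time and of the last grid point before t. *)
Definition last_sw (t : R) : nat :=
  \max_(l < N.+1 | tau delta l <= t) l.

Definition last_gp (t : R) : nat :=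
  \max_(m < (ngrid g delta (last_sw t)).+1 | gtime g delta (last_sw t) m <= t)
     m.

(* Phi(t, tau_i), for i <= N and tau_i <= t <= T_delta. *)
Definition Phi (t : R) (i : nat) : 'M[R]_(nx + 1) :=
  let l := last_sw t in let m := last_gp t in
  expmx ((t - gtime g delta l m) *: A l m)
    *m lprod 0 m (step_exp l) *m Phi_sw l i.

Variables (Q E : 'M[R]_(nx + 1)).

Definition Pmx (i : nat) : 'M[R]_(nx + 1) :=
  mxint (tau delta i) (final_time delta) (fun t => (Phi t i)^T *m Q *m Phi t i).

Definition Fmx (i : nat) : 'M[R]_(nx + 1) :=
  (Phi_sw N.+1 i)^T *m E *m Phi_sw N.+1 i.

Definition Smx (i : nat) : 'M[R]_(nx + 1) := Pmx i + Fmx i.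

Definition Cmx (i : nat) : 'M[R]_(nx + 1) :=
  let An := A i (ngrid g delta i) in
  Q + An^T *m Smx i.+1 + Smx i.+1 *m An.

End Dynamics.

(* Main.v *)
(** The modes A_i^j do not depend on the switching intervals d, so a trajectory
    is a finite product of matrix exponentials, and its cost is obtained by a
    backward recursion over the pieces (A, h):
      V  |->  int_0^h (e^{uA})^T Q e^{uA} du + (e^{hA})^T V e^{hA},
    starting from E.  Run from tau_i, it yields S_i.  Changing d_i changes only
    the length h of the last piece of the i-th switching interval, and the
    h-derivative of the recursion step is
    (e^{hA})^T (Q + A^T V + V A) e^{hA}; this is the gradient.  Differentiating
    once more, d_i acts on x_(l+1) when i <= l, and on S_(l+1) when l < i. *)

Require Import Defs.
From mathcomp Require Import all_boot all_order all_algebra.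
From mathcomp Require Import all_classical all_reals all_analysis.
From mathcomp Require Import measurable_realfun.
Set Implicit Arguments.
Unset Strict Implicit.
Unset Printing Implicit Defensive.
Import Order.TTheory GRing.Theory Num.Theory.
Import numFieldNormedType.Exports.
Local Open Scope classical_set_scope.
Local Open Scope ring_scope.

(** * Entrywise calculus of matrix-valued functions *)

Section MatrixCalculus.
Variable R : realType.

Definition mxderiv m n (F : R -> 'M[R]_(m, n)) (t : R) (dF : 'M[R]_(m, n)) :=
  forall i j, is_derive t (1 : R) (fun s => F s i j) (dF i j).

Lemma is_derive_mxderiv m n (F : R -> 'M[R]_(m, n)) t dF :
  is_derive t (1 : R) F dF -> mxderiv F t dF.
Proof.
move=> [F1 F2] i j; split; first by move/derivable_mxP: F1.
by rewrite -F2 derive_mx// mxE.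
Qed.

Lemma mxderiv_cst m n (C : 'M[R]_(m, n)) t : mxderiv (fun=> C) t 0.
Proof. by move=> i j; rewrite mxE; exact: is_derive_cst. Qed.

Lemma mxderivD m n (F G : R -> 'M[R]_(m, n)) t dF dG :
  mxderiv F t dF -> mxderiv G t dG -> mxderiv (fun s => F s + G s) t (dF + dG).
Proof.
move=> hF hG i j; rewrite mxE.
rewrite (_ : (fun s => _) = (fun s => F s i j) + (fun s => G s i j)).
  by apply: is_deriveD; [exact: hF|exact: hG].
by apply/funext => s; rewrite mxE.
Qed.

Lemma mxderivM m n p (F : R -> 'M[R]_(m, n)) (G : R -> 'M[R]_(n, p)) t dF dG :
  mxderiv F t dF -> mxderiv G t dG ->
  mxderiv (fun s => F s *m G s) t (dF *m G t + F t *m dG).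
Proof.
move=> hF hG i j.
rewrite (_ : (fun s => _) = \sum_k ((fun s => F s i k) * (fun s => G s k j))).
  rewrite mxE !mxE -big_split/=.
  apply: is_derive_sum => k; rewrite addrC [dF i k * _]mulrC.
  exact: is_deriveM.
by apply/funext => s; rewrite mxE fct_sumE.
Qed.

Lemma mxderiv_addl m n (C : 'M[R]_(m, n)) (F : R -> 'M[R]_(m, n)) t dF :
  mxderiv F t dF -> mxderiv (fun s => C + F s) t dF.
Proof.
by rewrite -[in X in _ -> X](add0r dF); exact/mxderivD/mxderiv_cst.
Qed.

Lemma mxderiv_mull m n p (B : 'M[R]_(m, n)) (F : R -> 'M[R]_(n, p)) t dF :
  mxderiv F t dF -> mxderiv (fun s => B *m F s) t (B *m dF).
Proof.
by move=> /(mxderivM (mxderiv_cst B t)); rewrite mul0mx add0r.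
Qed.

Lemma mxderiv_mulr m n p (C : 'M[R]_(n, p)) (F : R -> 'M[R]_(m, n)) t dF :
  mxderiv F t dF -> mxderiv (fun s => F s *m C) t (dF *m C).
Proof.
by move=> /mxderivM/(_ (mxderiv_cst C t)); rewrite mulmx0 addr0.
Qed.

Lemma mxderiv_tr m n (F : R -> 'M[R]_(m, n)) t dF :
  mxderiv F t dF -> mxderiv (fun s => (F s)^T) t dF^T.
Proof.
move=> hF i j; rewrite mxE.
by under eq_fun do rewrite mxE; exact: hF.
Qed.

Lemma mxderiv_quad m n (V : 'M[R]_m) (F : R -> 'M[R]_(m, n)) t dF :
  mxderiv F t dF -> mxderiv (fun s => (F s)^T *m V *m F s) t
    (dF^T *m V *m F t + (F t)^T *m V *m dF).
Proof.
by move=> hF; apply: mxderivM (hF); exact/mxderiv_mulr/mxderiv_tr.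
Qed.

Lemma mxderiv_shift m n (F : R -> 'M[R]_(m, n)) (a : R) t dF :
  mxderiv F (t + a) dF -> mxderiv (fun s => F (s + a)) t dF.
Proof.
move=> hF i j; rewrite -[dF i j]mulr1.
apply: (@is_derive1_comp _ (fun s => F s i j) (fun s => s + a)) => //.
rewrite -[X in is_derive _ _ _ X]addr0.
rewrite (_ : (fun s => _) = id + cst a) //.
exact: is_deriveD.
Qed.

Lemma mxderiv_shift0 m n (F : R -> 'M[R]_(m, n)) (a : R) dF :
  mxderiv F a dF -> mxderiv (fun s => F (s + a)) 0 dF.
Proof. by move=> hF; apply: mxderiv_shift; rewrite add0r. Qed.

Lemma mxderiv_opp m n (F : R -> 'M[R]_(m, n)) t dF :
  mxderiv F (- t) dF -> mxderiv (fun s => F (- s)) t (- dF).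
Proof.
move=> hF i j; rewrite mxE -mulrN1.
by apply: (@is_derive1_comp _ (fun s => F s i j) -%R).
Qed.

Lemma mxderiv_continuous m n (F dF : R -> 'M[R]_(m, n)) i j :
  (forall t, mxderiv F t (dF t)) -> continuous (fun t => F t i j).
Proof.
move=> hF t; apply: differentiable_continuous; apply/derivable1_diffP.
by case: (hF t i j).
Qed.

Lemma cvg_fsum (T : Type) (F : set_system T) n (u : 'I_n -> T -> R)
    (l : 'I_n -> R) : Filter F ->
  (forall k, u k x @[x --> F] --> l k) ->
  \sum_k u k x @[x --> F] --> \sum_k l k.
Proof.
move=> FF ul; apply: cvg_big => //; exact: add_continuous.
Qed.

Lemma cvg_mx_coord m n (u : nat -> 'M[R]_(m, n)) (L : 'M[R]_(m, n)) :
  (forall i j, u k i j @[k --> \oo] --> L i j) -> u @ \oo --> L.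
Proof.
move=> uL; apply/cvgrPdist_le => /= e e0; near=> k.
rewrite /Num.Def.normr/= mx_normrE (bigmax_le _ (ltW e0))//= => i _.
rewrite !mxE/=.
move: i; near: k; apply: filter_forall => /= i.
exact: ((cvgrPdist_le _ _).1 (uL i.1 i.2)).
Unshelve. all: by end_near. Qed.

End MatrixCalculus.

(** * The matrix exponential and linear flows *)

Section MatrixExponential.
Variables (R : realType) (n : nat).
Implicit Types A B : 'M[R]_n.

Definition expmx_coef A B (i j : 'I_n) (k : nat) : R :=
  (B *m A ^+ k) i j / k`!%:R.

Lemma expmx_coef_bound A B i j : exists C a, [/\ 0 <= C, 0 <= a &
  forall k, `|expmx_coef A B i j k| <= C * (a ^+ k / k`!%:R)].
Proof.
pose a := \sum_k \sum_l `|A k l|; pose C := \sum_l `|B i l|.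
have a0 : 0 <= a by apply: sumr_ge0 => k _; exact: sumr_ge0.
have C0 : 0 <= C by exact: sumr_ge0.
exists C, a; split=> // k.
rewrite /expmx_coef normrM normfV [`|_%:R|]ger0_norm// mulrA.
rewrite ler_pM2r ?invr_gt0 ?ltr0n ?fact_gt0//.
have le_a l : \sum_m `|A l m| <= a.
  by rewrite /a [leRHS](bigD1 l)//= lerDl sumr_ge0// => ? _; exact: sumr_ge0.
have hA l : `|(A ^+ k) l j| <= a ^+ k.
  elim: k l => [|k ih] l.
    by rewrite expr0 mxE expr0; case: (_ == _); rewrite ?normr1 ?normr0.
  rewrite exprS mxE (le_trans (ler_norm_sum _ _ _))// exprS.
  apply: (@le_trans _ _ (\sum_m `|A l m| * a ^+ k)).
    by apply: ler_sum => m _; rewrite normrM ler_wpM2l.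
  by rewrite -mulr_suml ler_wpM2r// exprn_ge0.
rewrite mxE (le_trans (ler_norm_sum _ _ _))// mulr_suml.
by apply: ler_sum => l _; rewrite normrM ler_wpM2l.
Qed.

Lemma is_cvg_expmx_coef A B i j (x : R) : cvgn (pseries (expmx_coef A B i j) x).
Proof.
have [C [a [C0 a0 hC]]] := expmx_coef_bound A B i j.
apply: normed_cvg; rewrite /normed_series_of /=.
apply: (@series_le_cvg _ _ (fun k => C * exp_coeff (a * `|x|) k)).
- by move=> k /=.
- by move=> k /=; rewrite mulr_ge0// exp_coeff_ge0// mulr_ge0.
- move=> k /=; rewrite normrM normrX.
  apply: le_trans (ler_wpM2r _ (hC k)) _; first exact: exprn_ge0.
  by rewrite /exp_coeff /= exprMn -!mulrA [_^-1 * _]mulrC.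
- by apply: is_cvg_seriesZ; exact: is_cvg_series_exp_coeff.
Qed.

Lemma pseries_diffs_expmx_coef A B i j :
  pseries_diffs (expmx_coef A B i j) = expmx_coef A (B *m A) i j.
Proof.
apply/funext => k; rewrite /pseries_diffs /expmx_coef exprS -mulmxA.
by rewrite factS natrM invfM mulrCA [X in _ * X]mulrA mulfV ?mul1r//.
Qed.

Lemma expmx_partial A (t : R) N i j :
  (series (fun k : nat => (k`!%:R)^-1 *: (t *: A) ^+ k)) N i j =
  pseries (expmx_coef A 1%:M i j) t N.
Proof.
rewrite /pseries /series/= summxE; apply: eq_bigr => k _.
have -> : (t *: A) ^+ k = t ^+ k *: A ^+ k.
  elim: k => [|k ih]; first by rewrite !expr0 scale1r.
  by rewrite !exprS ih -[LHS]/(_ *m _) -scalemxAl -scalemxAr scalerA.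
by rewrite /expmx_coef mul1mx !mxE [LHS]mulrC -[LHS]mulrA [LHS]mulrC.
Qed.

Lemma expmx_cvg A (t : R) i j :
  pseries (expmx_coef A 1%:M i j) t @ \oo --> expmx (t *: A) i j.
Proof.
pose L := \matrix_(i, j) limn (pseries (expmx_coef A 1%:M i j) t).
suff -> : expmx (t *: A) = L by rewrite mxE; exact: is_cvg_expmx_coef.
apply/cvg_lim => //; apply: cvg_mx_coord => k l.
under eq_fun do rewrite expmx_partial.
by rewrite mxE; exact: is_cvg_expmx_coef.
Qed.

Lemma expmx_cvg_mul A B (t : R) i j :
  pseries (expmx_coef A B i j) t @ \oo --> (B *m expmx (t *: A)) i j.
Proof.
rewrite mxE.
rewrite (_ : pseries _ _ =
    fun N => \sum_k B i k * pseries (expmx_coef A 1%:M k j) t N).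
  by apply: cvg_fsum => k; apply: cvgMl_tmp; exact: expmx_cvg.
apply/funext => N; under [RHS]eq_bigr do rewrite mulr_sumr.
rewrite exchange_big/= /pseries /series/=; apply: eq_bigr => m _.
rewrite /expmx_coef mxE !mulr_suml; apply: eq_bigr => k _.
by rewrite mul1mx !mulrA.
Qed.

Lemma expmx_comm A (t : R) : A *m expmx (t *: A) = expmx (t *: A) *m A.
Proof.
apply/matrixP => i j.
have <- := cvg_lim _ (expmx_cvg_mul (A:=A) (B:=A) (t:=t) (i:=i) (j:=j)) => //.
apply: cvg_lim => //; rewrite [(_ *m A) i j]mxE.
rewrite (_ : pseries _ _ =
    fun N => \sum_k pseries (expmx_coef A 1%:M i k) t N * A k j).
  by apply: cvg_fsum => k; apply: cvgMr_tmp; exact: expmx_cvg.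
apply/funext => N; under [RHS]eq_bigr do rewrite mulr_suml.
rewrite exchange_big/= /pseries /series/=; apply: eq_bigr => m _.
rewrite /expmx_coef -[A *m A ^+ m]exprS exprSr mxE !mulr_suml.
apply: eq_bigr => k _.
by rewrite mul1mx [RHS]mulrAC; congr (_ * _); rewrite mulrAC.
Qed.

Lemma mxderiv_expmx A (t : R) :
  mxderiv (fun s => expmx (s *: A)) t (A *m expmx (t *: A)).
Proof.
move=> i j.
rewrite (_ : (fun s => _) = fun s => limn (pseries (expmx_coef A 1%:M i j) s)).
  rewrite -(cvg_lim _ (expmx_cvg_mul (A:=A) (B:=A) (t:=t) (i:=i) (j:=j)))//.
  have -> : expmx_coef A A i j = pseries_diffs (expmx_coef A 1%:M i j).
    by rewrite pseries_diffs_expmx_coef mul1mx.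
  apply: (@pseries_snd_diffs _ _ (`|t| + 1)).
  - exact: is_cvg_expmx_coef.
  - by rewrite pseries_diffs_expmx_coef; exact: is_cvg_expmx_coef.
  - by rewrite !pseries_diffs_expmx_coef; exact: is_cvg_expmx_coef.
  - by rewrite [ltRHS]ger0_norm ?ltrDl// addr_ge0.
by apply/funext => s; apply/esym/cvg_lim => //; exact: expmx_cvg.
Qed.

Lemma mxderiv_expmxN A (t : R) :
  mxderiv (fun s => expmx (- s *: A)) t (- (A *m expmx (- t *: A))).
Proof.
apply: (@mxderiv_opp _ _ _ (fun u => expmx (u *: A))).
exact: mxderiv_expmx.
Qed.

Lemma expmx0 : expmx 0 = 1%:M :> 'M[R]_n.
Proof.
apply/matrixP => i j; have := @expmx_cvg 0 0 i j; rewrite scaler0.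
move/cvg_lim => <- //; apply: cvg_lim => //.
rewrite -(cvg_shiftn 1)/=.
rewrite (_ : (fun k => _) = cst ((1%:M : 'M[R]_n) i j)); first exact: cvg_cst.
apply/funext => k; rewrite addn1 /pseries /series/= big_nat_recl//=.
rewrite big1 ?addr0; last by move=> ? _; rewrite expr0n mulr0.
by rewrite /expmx_coef expr0 mul1mx fact0 divr1 mulr1.
Qed.

End MatrixExponential.

Section LinearFlow.
Variables (R : realType) (n : nat).
Implicit Types A Q : 'M[R]_n.

Lemma mxderiv0_cst m p (F : R -> 'M[R]_(m, p)) :
  (forall t, mxderiv F t 0) -> forall s t, F s = F t.
Proof.
move=> F0 s t; apply/matrixP => i j.
apply: (@is_derive_0_is_cst _ (fun u => F u i j)) => u.
by have := F0 u i j; rewrite mxE.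
Qed.

Lemma expmxNK A (t : R) : expmx (- t *: A) *m expmx (t *: A) = 1%:M.
Proof.
pose F s := expmx (- s *: A) *m expmx (s *: A).
rewrite -[LHS]/(F t) (@mxderiv0_cst _ _ F _ t 0); last first.
  move=> s.
  have -> : 0 = - (A *m expmx (- s *: A)) *m expmx (s *: A)
              + expmx (- s *: A) *m (A *m expmx (s *: A)).
    by rewrite (expmx_comm A (- s)) mulNmx !mulmxA addNr.
  apply: mxderivM; last exact: mxderiv_expmx.
  exact: mxderiv_expmxN.
by rewrite /F oppr0 scale0r expmx0 mulmx1.
Qed.

Lemma expmxKN A (t : R) : expmx (t *: A) *m expmx (- t *: A) = 1%:M.
Proof. by have := expmxNK A (- t); rewrite opprK. Qed.

Lemma flow_unique m A (F : R -> 'M[R]_(n, m)) (a b : R) :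
  (forall t, a < t < b -> mxderiv F t (A *m F t)) ->
  (forall i j, {within `[a, b], continuous (fun t => F t i j)}) ->
  forall t, a <= t <= b -> F t = expmx ((t - a) *: A) *m F a.
Proof.
move=> dF cF t /andP[at_ tb].
pose e s := expmx (- (s - a) *: A); pose Z s := e s *m F s.
have de s : mxderiv e s (- (A *m e s)).
  apply: (@mxderiv_shift _ _ _ (fun u => expmx (- u *: A)) (- a)).
  exact: mxderiv_expmxN.
have ZE : Z t = Z a.
  apply/matrixP => i j; apply/eqP; rewrite -subr_eq0; apply/eqP.
  have [|||c _ ->] := @MVT_segment _ (fun s => Z s i j) (cst 0) a t.
  - by [].
  - move=> s; rewrite in_itv/= => /andP[as_ st].
    have := mxderivM (de s) (dF s _) i j.
    rewrite as_ (lt_le_trans st tb) => /(_ isT).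
    by rewrite /e (expmx_comm A (- (s - a))) mulNmx !mulmxA addNr mxE.
  - apply: (@continuous_subspaceW _ _ _ `[a, b]).
      by move=> s /=; rewrite !in_itv/= => /andP[-> st]; exact: le_trans tb.
    rewrite (_ : (fun s => _) = fun s => \sum_k e s i k * F s k j); last first.
      by apply/funext => s; rewrite mxE.
    move=> s; apply: cvg_fsum => k; apply: cvgM; last exact: cF.
    exact: (continuous_subspaceT (mxderiv_continuous (i:=i) (j:=k) de)).
  - by rewrite mul0r.
have := congr1 (mulmx (expmx ((t - a) *: A))) ZE.
rewrite /Z /e subrr oppr0 scale0r expmx0 mul1mx => <-.
by rewrite mulmxA expmxKN mul1mx.
Qed.

(* Van Loan's trick: the upper right block U of e^{sZ}, Z being this matrix,
   satisfies U' = - A^T U + Q e^{sA}, so (e^{sA})^T U is a primitive of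
   (e^{sA})^T Q e^{sA}, for negative s as well. *)
Definition van_loan Q A : 'M[R]_(n + n) := block_mx (- A^T) Q 0 A.

Definition gram Q A (s : R) : 'M[R]_n :=
  (expmx (s *: A))^T *m ursubmx (expmx (s *: van_loan Q A)).

Let blockE Q A (s : R) : van_loan Q A *m expmx (s *: van_loan Q A) =
  let X := expmx (s *: van_loan Q A) in
  block_mx (- A^T *m ulsubmx X + Q *m dlsubmx X)
           (- A^T *m ursubmx X + Q *m drsubmx X)
           (A *m dlsubmx X) (A *m drsubmx X).
Proof.
move=> /=; rewrite -[in LHS](submxK (expmx _)) /van_loan mulmx_block.
by rewrite !mul0mx !add0r.
Qed.

Lemma expmx_van_loan_dr Q A (s : R) :
  drsubmx (expmx (s *: van_loan Q A)) = expmx (s *: A).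
Proof.
pose F t := drsubmx (expmx (t *: van_loan Q A)).
have dF t : mxderiv F t (A *m F t).
  move=> i j.
  have := @mxderiv_expmx _ _ (van_loan Q A) t (rshift n i) (rshift n j).
  rewrite blockE/= block_mxEdr.
  by congr is_derive; apply/funext => u; rewrite !mxE.
have F0 : F 0 = 1%:M.
  by rewrite /F scale0r expmx0 scalar_mx_block block_mxKdr.
have FA t : expmx (- t *: A) *m F t = 1%:M.
  pose Z t := expmx (- t *: A) *m F t.
  rewrite -[LHS]/(Z t) (@mxderiv0_cst _ _ Z _ t 0).
    by rewrite /Z F0 oppr0 scale0r expmx0 mulmx1.
  move=> u.
  have -> : 0 = - (A *m expmx (- u *: A)) *m F u
              + expmx (- u *: A) *m (A *m F u).
    by rewrite (expmx_comm A (- u)) mulNmx !mulmxA addNr.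
  apply: mxderivM; last exact: dF.
  exact: mxderiv_expmxN.
have := congr1 (mulmx (expmx (s *: A))) (FA s).
by rewrite mulmxA expmxKN mul1mx mulmx1.
Qed.

Lemma gram0 Q A : gram Q A 0 = 0.
Proof.
by rewrite /gram !scale0r !expmx0 scalar_mx_block block_mxKur mulmx0.
Qed.

Lemma mxderiv_gram Q A (s : R) :
  mxderiv (gram Q A) s ((expmx (s *: A))^T *m Q *m expmx (s *: A)).
Proof.
have -> : (expmx (s *: A))^T *m Q *m expmx (s *: A) =
    (A *m expmx (s *: A))^T *m ursubmx (expmx (s *: van_loan Q A)) +
    (expmx (s *: A))^T *m (- A^T *m ursubmx (expmx (s *: van_loan Q A))
                           + Q *m expmx (s *: A)).
  by rewrite mulmxDr addrA trmx_mul mulNmx mulmxN !mulmxA addrN add0r.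
apply: mxderivM; first by apply: mxderiv_tr; exact: mxderiv_expmx.
move=> i j.
have := @mxderiv_expmx _ _ (van_loan Q A) s (lshift n i) (rshift n j).
rewrite blockE/= block_mxEur expmx_van_loan_dr.
by congr is_derive; apply/funext => u; rewrite !mxE.
Qed.

Lemma gram_sym Q A (s : R) : Q^T = Q -> (gram Q A s)^T = gram Q A s.
Proof.
move=> QT; apply/eqP; rewrite -subr_eq0; apply/eqP.
pose Z t := (gram Q A t)^T - gram Q A t.
rewrite -[LHS]/(Z s) (@mxderiv0_cst _ _ Z _ s 0).
  by rewrite /Z gram0 trmx0 subr0.
move=> t i j; rewrite mxE.
have d1 := mxderiv_gram Q A t i j; have d2 := mxderiv_gram Q A t j i.
have E (B : 'M[R]_n) : (B^T - B) i j = B j i - B i j by rewrite !mxE.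
have -> : (fun u => Z u i j) =
    (fun u => gram Q A u j i) - (fun u => gram Q A u i j).
  by apply/funext => u; exact: E.
have := is_deriveB d2 d1; set B := _ *m _.
have -> : B j i = B^T i j by rewrite [RHS]mxE.
have -> : B^T = B by rewrite /B !trmx_mul trmxK QT !mulmxA.
by rewrite subrr; exact.
Qed.

End LinearFlow.

(** * Integrals of piecewise smooth functions *)

Section DefiniteIntegral.
Variable R : realType.
Implicit Types (f : R -> R) (a b : R).
Local Notation mu := (@lebesgue_measure R).

Definition has_int f a b (v : R) := [/\ a <= b, measurable_fun `[a, b] f &
  (\int[mu]_(t in `[a, b]) (f t)%:E = v%:E)%E].

Lemma has_int_Rintegral f a b v : has_int f a b v ->
  (\int[mu]_(t in `[a, b]) f t)%R = v.
Proof. by case=> _ _; rewrite /Rintegral => ->. Qed.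

Lemma has_int_point f a : has_int f a a 0.
Proof.
split=> //; first by rewrite set_itv1; exact: measurable_fun_set1.
by rewrite set_itv1 integral_set1.
Qed.

Lemma has_int_cat f a b c v w :
  has_int f a b v -> has_int f b c w -> has_int f a c (v + w).
Proof.
move=> [ab mab iab] [bc mbc ibc].
have acE : `[a, c]%classic = `[a, b] `|` `]b, c].
  by rewrite (@itv_bndbnd_setU _ _ _ (BRight b)) ?bnd_simp.
have mbc' : measurable_fun `]b, c] f.
  by apply: measurable_funS mbc => //; exact: subset_itv_oc_cc.
have mac : measurable_fun (`[a, b] `|` `]b, c]) f by apply/measurable_funU.
split; first exact: le_trans bc.
  by rewrite acE.
rewrite acE integral_setU//=.
- rewrite iab integral_itv_obnd_cbnd; last exact/measurable_EFinP.
  by rewrite ibc EFinD.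
- exact/measurable_EFinP.
- apply/disj_setPS => y [/=]; rewrite !in_itv/= => /andP[_ yb] /andP[].
  by rewrite ltNge yb.
Qed.

Lemma has_int_derive f F dF a b : a <= b ->
  (forall t, is_derive t (1 : R) F (dF t)) -> continuous dF ->
  (forall t, a < t < b -> f t = dF t) -> has_int f a b (F b - F a).
Proof.
rewrite le_eqVlt => /predU1P[<- *|ab hF cdF fE].
  by rewrite subrr; exact: has_int_point.
have fE' : {in `]a, b[, dF =1 f}.
  by move=> t; rewrite in_itv => /fE.
have mdF : measurable_fun `]a, b[ dF.
  by apply: measurable_funS (continuous_measurable_fun cdF).
have mf : measurable_fun `]a, b[ f.
  by apply: eq_measurable_fun mdF => t; rewrite inE => /fE'.
split; first exact: ltW.
  exact: measurable_fun_itv_cc mf.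
rewrite (@eq_integral_itv_bounded _ _ _ dF)//.
have cF : continuous F.
  move=> t; apply: differentiable_continuous; apply/derivable1_diffP.
  by case: (hF t).
rewrite (@continuous_FTC2 _ _ F)//.
- exact: continuous_subspaceT.
- split.
  + by move=> t _; case: (hF t).
  + exact/cvg_at_right_filter/cF.
  + exact/cvg_at_left_filter/cF.
- by move=> t _; rewrite derive1E; case: (hF t).
Qed.

End DefiniteIntegral.

(** * Piecewise linear flows and their quadratic cost *)

Section Pieces.
Variables (R : realType) (n : nat).
Implicit Types (A Q E : 'M[R]_n) (p : seq ('M[R]_n * R)).

Fixpoint flow p : 'M[R]_n :=
  if p is (A, h) :: p' then flow p' *m expmx (h *: A) else 1%:M.

Definition duration p : R := \sum_(x <- p) x.2.

Fixpoint quadcost Q E p : 'M[R]_n :=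
  if p is (A, h) :: p' then
    gram Q A h + (expmx (h *: A))^T *m quadcost Q E p' *m expmx (h *: A)
  else E.

Fixpoint follows m p (a : R) (y : 'M[R]_(n, m)) (Y : R -> 'M[R]_(n, m)) :
    Prop :=
  if p is (A, h) :: p' then
    [/\ 0 <= h, forall t, a < t < a + h -> Y t = expmx ((t - a) *: A) *m y &
        follows p' (a + h) (expmx (h *: A) *m y) Y]
  else True.

Lemma flow_cat p1 p2 : flow (p1 ++ p2) = flow p2 *m flow p1.
Proof.
by elim: p1 => [|[A h] p1 ih] /=; rewrite ?mulmx1// ih mulmxA.
Qed.

Lemma flow_rcons p A (h : R) :
  flow (rcons p (A, h)) = expmx (h *: A) *m flow p.
Proof.
rewrite -cats1 flow_cat /=; congr (_ *m _).
exact: mul1mx.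
Qed.

Lemma duration_cat p1 p2 : duration (p1 ++ p2) = duration p1 + duration p2.
Proof. by rewrite /duration big_cat. Qed.

Lemma quadcost_cat Q E p1 p2 :
  quadcost Q E (p1 ++ p2) = quadcost Q (quadcost Q E p2) p1.
Proof. by elim: p1 => [//|[A h] p1 /= ->]. Qed.

Lemma quadcost_split Q E p :
  quadcost Q E p = quadcost Q 0 p + (flow p)^T *m E *m flow p.
Proof.
elim: p => [|[A h] p /= ->]; first by rewrite /= trmx1 mul1mx mulmx1 add0r.
by rewrite mulmxDr mulmxDl addrA trmx_mul !mulmxA.
Qed.

Lemma quadcost_sym Q E p : Q^T = Q -> E^T = E ->
  (quadcost Q E p)^T = quadcost Q E p.
Proof.
move=> QT ET; elim: p => [//|[A h] p /= ih].
by rewrite linearD/= gram_sym// !trmx_mul trmxK ih mulmxA.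
Qed.

Lemma follows_cat m p1 p2 a (y : 'M[R]_(n, m)) Y :
  follows p1 a y Y -> follows p2 (a + duration p1) (flow p1 *m y) Y ->
  follows (p1 ++ p2) a y Y.
Proof.
elim: p1 a y => [|[A h] p1 ih] a y /=.
  by rewrite /duration big_nil addr0 mul1mx.
rewrite /duration big_cons/= addrA -mulmxA => -[h0 Yp fp] f2.
by split=> //; exact: ih.
Qed.

Lemma follows_int m Q p a (y : 'M[R]_(n, m)) Y k l : follows p a y Y ->
  has_int (fun t => ((Y t)^T *m Q *m Y t) k l) a (a + duration p)
    ((y^T *m quadcost Q 0 p *m y) k l).
Proof.
elim: p a y => [|[A h] p ih] a y /=.
  move=> _; rewrite /duration big_nil addr0 mulmx0 mul0mx mxE.
  exact: has_int_point.
move=> [h0 Yp /ih int2].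
rewrite mulmxDr mulmxDl mxE /duration big_cons/= addrA.
have conj_mul (B V : 'M[R]_n) :
    (B *m y)^T *m V *m (B *m y) = y^T *m (B^T *m V *m B) *m y.
  by rewrite trmx_mul !mulmxA.
rewrite conj_mul in int2; apply: has_int_cat int2.
pose F t := y^T *m gram Q A (t - a) *m y.
pose e t := expmx ((t - a) *: A).
pose dF t := y^T *m ((e t)^T *m Q *m e t) *m y.
have de t : mxderiv e t (A *m e t).
  apply: (@mxderiv_shift _ _ _ (fun u => expmx (u *: A)) (- a)).
  exact: mxderiv_expmx.
have hF t : mxderiv F t (dF t).
  apply/mxderiv_mulr/mxderiv_mull.
  by apply: (@mxderiv_shift _ _ _ (gram Q A) (- a)); exact: mxderiv_gram.
have Fah : F (a + h) = y^T *m gram Q A h *m y by rewrite /F [a + h]addrC addrK.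
have Fa : F a = 0 by rewrite /F subrr gram0 mulmx0 mul0mx.
have -> : (y^T *m gram Q A h *m y) k l = F (a + h) k l - F a k l.
  by rewrite Fah Fa [X in _ - X]mxE subr0.
apply: (@has_int_derive _ _ (fun t => F t k l) (fun t => dF t k l)).
- by rewrite lerDl.
- by move=> t; exact: hF.
- apply: mxderiv_continuous => t; apply/mxderiv_mulr/mxderiv_mull.
  exact: mxderiv_quad (de t).
- by move=> t /Yp ->; rewrite /dF /e trmx_mul !mulmxA.
Qed.

Lemma mxderiv_flow A p1 p2 (h : R) :
  mxderiv (fun s => flow (p1 ++ (A, s) :: p2)) h
    (flow p2 *m A *m flow (rcons p1 (A, h))).
Proof.
under [X in mxderiv X]eq_fun do rewrite flow_cat/=.
rewrite flow_rcons mulmxA -(mulmxA (flow p2)).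
exact/mxderiv_mulr/mxderiv_mull/mxderiv_expmx.
Qed.

Lemma mxderiv_quadcost Q E A p1 p2 (h : R) :
  let B := flow (rcons p1 (A, h)) in let V := quadcost Q E p2 in
  mxderiv (fun s => quadcost Q E (p1 ++ (A, s) :: p2)) h
    (B^T *m (Q + A^T *m V + V *m A) *m B).
Proof.
move=> B V.
under [X in mxderiv X]eq_fun do rewrite quadcost_cat quadcost_split/= -/V.
have conjE (e P : 'M[R]_n) :
    (e *m P)^T *m (Q + A^T *m V + V *m A) *m (e *m P) =
    P^T *m (e^T *m Q *m e +
            ((A *m e)^T *m V *m e + e^T *m V *m (A *m e))) *m P.
  by rewrite !trmx_mul !(mulmxDr, mulmxDl) !mulmxA !addrA.
rewrite /B flow_rcons conjE.
apply/mxderiv_addl/mxderiv_mulr/mxderiv_mull/mxderivD.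
  exact: mxderiv_gram.
exact/mxderiv_quad/mxderiv_expmx.
Qed.

End Pieces.

(** * Switching times and grid points *)

Section Timeline.
Variables (R : realType) (N : nat) (g : seq R) (delta : 'rV[R]_N.+1).
Hypothesis g_sorted : sorted <=%R g.
Implicit Types d : 'rV[R]_N.+1.

Lemma tau0 d : tau d 0 = 0.
Proof. by rewrite /tau big_pred0. Qed.

Lemma le_tau d i j : (forall k, 0 <= d 0 k) -> (i <= j)%N -> tau d i <= tau d j.
Proof.
move=> d0 ij; rewrite /tau [leRHS](bigID (fun k : 'I_N.+1 => (k < i)%N))/=.
rewrite [X in _ <= X + _](eq_bigl (fun k : 'I_N.+1 => (k < i)%N)) => [|k].
  by rewrite lerDl sumr_ge0.
by apply/andb_idl => /leq_trans; apply.
Qed.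

Hypothesis delta0 : forall k, 0 <= delta 0 k.

Lemma gtime_le q j k : (j <= k)%N -> (k <= (ngrid g delta q).+1)%N ->
  gtime g delta q j <= gtime g delta q k.
Proof.
move=> jk kn; pose s := tau delta q :: rcons (inner g delta q) (tau delta q.+1).
have nthE i : gtime g delta q i = nth (tau delta q.+1) s i.
  by rewrite /gtime /s -rcons_cons nth_rcons_default.
rewrite !nthE; apply: (sorted_leq_nth le_trans le_refl) => //.
- rewrite /s /= rcons_path; apply/andP; split.
    rewrite path_min_sorted.
      by apply: sorted_filter => //; exact: le_trans.
    by apply/allP => t; rewrite mem_filter => /andP[/andP[/ltW]].
  have := mem_last (tau delta q) (inner g delta q).
  rewrite inE => /predU1P[->|].
    exact: le_tau.
  by rewrite mem_filter => /andP[/andP[_ /ltW]].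
- by rewrite inE /s /= size_rcons; exact: leq_ltn_trans jk _.
- by rewrite inE /s /= size_rcons.
Qed.

Lemma node0 d q : node g delta d q 0 = tau d q.
Proof. by rewrite /node /gtime/= subrr addr0. Qed.

Lemma node_last d q : node g delta d q (ngrid g delta q).+1 = tau d q.+1.
Proof. by rewrite /node ltnn. Qed.

Lemma admissible_ge0 d : admissible g delta d -> forall k, 0 <= d 0 k.
Proof.
move=> dD k; apply: le_trans (dD k); rewrite subr_ge0.
by have := @gtime_le k 0 (ngrid g delta k); apply.
Qed.

Lemma node_leS d (q : 'I_N.+1) j : admissible g delta d ->
  (j <= ngrid g delta q)%N -> node g delta d q j <= node g delta d q j.+1.
Proof.
move=> dD jn; rewrite /node jn; case: ltnP => [jn'|nj].
  by rewrite lerD2l lerD2r gtime_le// ltnW.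
have -> : j = ngrid g delta q by apply/eqP; rewrite eqn_leq jn.
by rewrite tauS lerD2l; exact: dD.
Qed.

Lemma node_bounds d (q : 'I_N.+1) j : admissible g delta d ->
  (j <= (ngrid g delta q).+1)%N -> tau d q <= node g delta d q j <= tau d q.+1.
Proof.
move=> dD jn; have mono k l : (k + l <= (ngrid g delta q).+1)%N ->
    node g delta d q k <= node g delta d q (k + l).
  elim: l => [|l ih]; first by rewrite addn0.
  rewrite addnS => kl; apply: le_trans (ih (ltnW kl)) _.
  exact: node_leS.
rewrite -{1}node0 -node_last (mono 0%N j)//=.
by have := mono j ((ngrid g delta q).+1 - j)%N; rewrite subnKC//; apply.
Qed.

Lemma last_swE (q : 'I_N.+1) (t : R) : tau delta q <= t < tau delta q.+1 ->
  last_sw delta t = q.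
Proof.
move=> /andP[qt tq]; apply/eqP.
rewrite eqn_leq /last_sw leq_bigmax_cond// andbT.
apply/bigmax_leqP => k kt; rewrite leqNgt; apply/negP => qk.
by have := le_lt_trans (le_trans (le_tau delta0 qk) kt) tq; rewrite ltxx.
Qed.

Lemma last_gpE (q : 'I_N.+1) j (t : R) : (j <= ngrid g delta q)%N ->
  gtime g delta q j <= t < gtime g delta q j.+1 ->
  last_sw delta t = q /\ last_gp g delta t = j.
Proof.
move=> jn /andP[jt tj].
have swE : last_sw delta t = q.
  apply: last_swE; have := gtime_le (q := q) (leq0n j) (leqW jn).
  move=> /le_trans -> //=; apply: lt_le_trans tj _.
  rewrite -node_last node_id; apply: gtime_le => //.
split=> //; rewrite /last_gp swE; apply/eqP; rewrite eqn_leq; apply/andP; split.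
  apply/bigmax_leqP => k kt; rewrite leqNgt; apply/negP => jk.
  have := le_lt_trans (le_trans (gtime_le jk (leqW _)) kt) tj.
  by rewrite ltxx -ltnS => /(_ (ltn_ord k)).
by apply: (@leq_bigmax_cond _ _ _ (Ordinal (_ : (j < (ngrid g delta q).+1)%N))).
Qed.

End Timeline.

Section PieceLists.
Variables (R : realType) (N nx : nat) (g : seq R) (delta : 'rV[R]_N.+1).
Variable A : nat -> nat -> 'M[R]_(nx + 1).
Implicit Types d : 'rV[R]_N.+1.

Definition subpieces d (q j : nat) : seq ('M[R]_(nx + 1) * R) :=
  [seq (A q k, node g delta d q k.+1 - node g delta d q k) | k <- iota 0 j].

Definition pieces d (a b : nat) : seq ('M[R]_(nx + 1) * R) :=
  flatten [seq subpieces d q (ngrid g delta q).+1 | q <- index_iota a b].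

Lemma subpiecesS d q j : subpieces d q j.+1 = rcons (subpieces d q j)
  (A q j, node g delta d q j.+1 - node g delta d q j).
Proof.
have iotaS : iota 0 j.+1 = rcons (iota 0 j) j by rewrite -addn1 iotaD cats1.
by rewrite /subpieces iotaS map_rcons.
Qed.

Lemma pieces_cat d a b c : (a <= b)%N -> (b <= c)%N ->
  pieces d a c = pieces d a b ++ pieces d b c.
Proof.
move=> ab bc; rewrite /pieces -flatten_cat -map_cat; congr (flatten (map _ _)).
rewrite /index_iota; have -> : (c - a = (b - a) + (c - b))%N.
  by rewrite addnC addnBA// subnK.
by rewrite iotaD subnKC.
Qed.

Lemma piecesS d a b : (a <= b)%N -> pieces d a b.+1 =
  pieces d a b ++ subpieces d b (ngrid g delta b).+1.
Proof.
move=> ab; rewrite (@pieces_cat d a b)//; congr (_ ++ _).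
by rewrite /pieces /index_iota subSnn /= cats0.
Qed.

Lemma pieces_nil d a : pieces d a a = [::].
Proof. by rewrite /pieces /index_iota subnn. Qed.

Lemma duration_subpieces d q j :
  duration (subpieces d q j) = node g delta d q j - tau d q.
Proof.
rewrite -(node0 g delta); elim: j => [|j ih].
  by rewrite /duration big_nil subrr.
by rewrite subpiecesS -cats1 duration_cat ih /duration big_seq1/= addrC subrKA.
Qed.

Lemma duration_pieces d a b : (a <= b)%N ->
  duration (pieces d a b) = tau d b - tau d a.
Proof.
move=> /subnKC <-; elim: (b - a)%N => [|k ih].
  by rewrite (addn0 a) pieces_nil /duration big_nil subrr.
rewrite (addnS a k) piecesS ?leq_addr// duration_cat ih.
rewrite duration_subpieces node_last.
by rewrite addrC subrKA.
Qed.

Lemma follows_pieces m d a b (y : 'M[R]_(nx + 1, m)) Y :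
  sorted <=%R g -> (forall k, 0 <= delta 0 k) -> admissible g delta d ->
  (a <= b)%N -> (b <= N.+1)%N ->
  (forall (q : 'I_N.+1) j t, (a <= q)%N -> (j <= ngrid g delta q)%N ->
     node g delta d q j < t < node g delta d q j.+1 ->
     Y t = expmx ((t - node g delta d q j) *: A q j)
             *m (flow (subpieces d q j) *m (flow (pieces d a q) *m y))) ->
  follows (pieces d a b) (tau d a) y Y.
Proof.
move=> gs d0 dD /subnKC <-; elim: (b - a)%N => [|k ih] + YE.
  by rewrite (addn0 a) pieces_nil.
rewrite (addnS a k) => akN; rewrite piecesS ?leq_addr//.
apply: follows_cat; first by apply: ih => //; exact: ltnW.
rewrite duration_pieces ?leq_addr// subrKC.
have {}YE := YE (Ordinal akN); rewrite /= in YE.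
set q := (a + k)%N in YE *.
suff H : forall j, (j <= (ngrid g delta q).+1)%N ->
  follows (subpieces d q j) (tau d q) (flow (pieces d a q) *m y) Y by exact: H.
elim=> [//|j ihj] jn; rewrite subpiecesS -cats1.
apply: follows_cat; first exact/ihj/ltnW.
rewrite duration_subpieces subrKC/= subr_ge0; split=> //.
  exact: (node_leS gs d0 (q := Ordinal akN)).
by move=> t; rewrite subrKC => tj; apply: YE => //; exact: leq_addr.
Qed.

End PieceLists.

Lemma lprodS (R : realType) n (a b : nat) (F : nat -> 'M[R]_n) : (a <= b)%N ->
  lprod a b.+1 F = F b *m lprod a b F.
Proof.
move=> ab; rewrite /lprod /index_iota subSn// -addn1 iotaD cats1 rev_rcons.
by rewrite big_cons subnKC.
Qed.

Lemma lprod_nil (R : realType) n (a : nat) (F : nat -> 'M[R]_n) :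
  lprod a a F = 1%:M.
Proof. by rewrite /lprod /index_iota subnn big_nil. Qed.

Section Trajectories.
Variables (R : realType) (N nx : nat) (g : seq R) (delta : 'rV[R]_N.+1).
Variable A : nat -> nat -> 'M[R]_(nx + 1).
Hypothesis g_sorted : sorted <=%R g.
Hypothesis delta0 : forall k, 0 <= delta 0 k.
Implicit Types d : 'rV[R]_N.+1.

Lemma trajectory_piece d z0 x (q : 'I_N.+1) j (t : R) :
  admissible g delta d -> is_trajectory g A delta d z0 x ->
  (j <= ngrid g delta q)%N ->
  node g delta d q j <= t <= node g delta d q j.+1 ->
  x t = expmx ((t - node g delta d q j) *: A q j) *m x (node g delta d q j).
Proof.
move=> dD [_ cx dx] jn; apply: flow_unique => [s sj|k l].
  by apply: is_derive_mxderiv; exact: dx.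
apply: (@continuous_subspaceW _ _ _ `[0, final_time d]).
  have d0 := admissible_ge0 g_sorted delta0 dD.
  have /andP[qj _] := node_bounds g_sorted delta0 dD (leqW jn).
  have /andP[_ jq] := @node_bounds _ _ _ _ g_sorted delta0 d q j.+1 dD jn.
  move=> s /=; rewrite !in_itv/= => /andP[js sj].
  rewrite (le_trans _ js)/=; last first.
    by rewrite (le_trans _ qj)// -(tau0 d); exact: le_tau.
  by rewrite (le_trans sj)// (le_trans jq)//; exact: le_tau.
move=> s; pose coord (B : 'cV[R]_(nx + 1)) := B k l.
apply: (@cvg_comp _ _ _ _ coord _ _ _ (cx s)).
exact: coord_continuous.
Qed.

Lemma trajectory_node d z0 x (q : 'I_N.+1) j :
  admissible g delta d -> is_trajectory g A delta d z0 x ->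
  (j <= (ngrid g delta q).+1)%N ->
  x (node g delta d q j) = flow (subpieces g delta A d q j) *m x (tau d q).
Proof.
move=> dD xT; elim: j => [|j ih] jn; first by rewrite node0 mul1mx.
rewrite (trajectory_piece dD xT jn); last first.
  by rewrite lexx andbT; exact: node_leS.
by rewrite (ih (ltnW jn)) subpiecesS flow_rcons mulmxA.
Qed.

Lemma trajectory_tau d z0 x q : admissible g delta d ->
  is_trajectory g A delta d z0 x -> (q <= N.+1)%N ->
  x (tau d q) = flow (pieces g delta A d 0 q) *m z0.
Proof.
move=> dD xT; elim: q => [|q ih] qN.
  by rewrite tau0 pieces_nil mul1mx; case: xT.
have := @trajectory_node d z0 x (Ordinal qN) _ dD xT (leqnn _).
rewrite node_last -[nat_of_ord _]/q => ->.
by rewrite (ih (ltnW qN)) (piecesS _ _ _ _ (leq0n q)) flow_cat mulmxA.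
Qed.

Lemma cost_quadcost Q E d z0 x : admissible g delta d ->
  is_trajectory g A delta d z0 x ->
  cost Q E d x = qform (quadcost Q E (pieces g delta A d 0 N.+1)) z0.
Proof.
move=> dD xT.
have fx : follows (pieces g delta A d 0 N.+1) (tau d 0) z0 x.
  apply: follows_pieces => // q j t _ jn /andP[/ltW jt /ltW tj].
  rewrite -(trajectory_tau dD xT) ?(ltnW (ltn_ord q))//.
  rewrite -(trajectory_node dD xT) ?leqW//.
  by apply: trajectory_piece dD xT _ _ => //; rewrite jt.
have := has_int_Rintegral (follows_int Q 0 0 fx).
rewrite duration_pieces// tau0 add0r subr0 /cost /qform => ->.
rewrite /final_time (trajectory_tau dD xT)// [in RHS]quadcost_split.
have addE (B V : 'M[R]_(nx + 1)) : (z0^T *m V *m z0) 0 0 +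
    ((B *m z0)^T *m E *m (B *m z0)) 0 0 =
    (z0^T *m (V + B^T *m E *m B) *m z0) 0 0.
  by rewrite mulmxDr mulmxDl [RHS]mxE trmx_mul !mulmxA.
exact: addE.
Qed.

Lemma lprod_step_exp q j :
  lprod 0 j (step_exp g A delta q) = flow (subpieces g delta A delta q j).
Proof.
elim: j => [|j ih]; first by rewrite lprod_nil.
rewrite (lprodS _ (leq0n j)) ih subpiecesS flow_rcons; congr (_ *m _).
by rewrite /step_exp /gstep !node_id.
Qed.

Lemma Phi_swE l i : (i <= l)%N ->
  Phi_sw g A delta l i = flow (pieces g delta A delta i l).
Proof.
move=> /subnKC <-; elim: (l - i)%N => [|k ih].
  by rewrite (addn0 i) pieces_nil /Phi_sw lprod_nil.
rewrite (addnS i k) (piecesS _ _ _ _ (leq_addr k i)) flow_cat -ih.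
rewrite -lprod_step_exp.
exact: lprodS (leq_addr k i).
Qed.

Lemma SmxE Q E i : (i <= N.+1)%N ->
  Smx g A delta Q E i = quadcost Q E (pieces g delta A delta i N.+1).
Proof.
move=> iN; have dD := admissible_id g delta0.
have fPhi : follows (pieces g delta A delta i N.+1) (tau delta i) 1%:M
    (fun t => Phi g A delta t i).
  apply: follows_pieces => // q j t iq jn /andP[jt tj].
  rewrite !node_id in jt tj *.
  have [] := @last_gpE _ _ _ _ g_sorted delta0 q j t jn.
    by rewrite (ltW jt).
  rewrite /Phi => swE gpE; rewrite gpE swE.
  by rewrite mulmx1 lprod_step_exp Phi_swE// mulmxA.
rewrite /Smx quadcost_split /Fmx Phi_swE//; congr (_ + _).
apply/matrixP => k l; rewrite mxE.
have := has_int_Rintegral (follows_int Q k l fPhi).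
by rewrite duration_pieces// subrKC trmx1 mul1mx mulmx1.
Qed.

Definition last_length (d : 'rV[R]_N.+1) (i : 'I_N.+1) : R :=
  d 0 i - (gtime g delta i (ngrid g delta i) - tau delta i).

Lemma subpieces_last d (q : 'I_N.+1) :
  subpieces g delta A d q (ngrid g delta q).+1 =
  rcons (subpieces g delta A delta q (ngrid g delta q))
        (A q (ngrid g delta q), last_length d q).
Proof.
rewrite subpiecesS; congr rcons; last first.
  by rewrite node_last /node leqnn tauS /last_length opprD addrACA subrr add0r.
apply/eq_in_map => k; rewrite mem_iota => /andP[_ kn]; congr (_, _).
rewrite !node_id /node kn (ltnW kn).
by rewrite opprD addrACA subrr add0r opprB addrA subrK.
Qed.

Let shift d (i : 'I_N.+1) h : 'rV[R]_N.+1 := d + h *: delta_mx 0 i.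

Lemma pieces_shift_notin d (i : 'I_N.+1) h a b : (b <= N.+1)%N ->
  ~~ (a <= i < b)%N ->
  pieces g delta A (shift d i h) a b = pieces g delta A d a b.
Proof.
move=> bN ni; rewrite /pieces; congr flatten; apply/eq_in_map => q.
rewrite mem_index_iota => /andP[aq qb].
have := subpieces_last (shift d i h) (Ordinal (leq_trans qb bN)).
have := subpieces_last d (Ordinal (leq_trans qb bN)) => /= -> ->.
congr (rcons _ (_, _)); rewrite /last_length !mxE /=.
case: eqVneq => [E|_]; last by rewrite mulr0 addr0.
by move: ni; rewrite -E/= aq qb.
Qed.

Definition pieces_upto_last d a (i : 'I_N.+1) : seq ('M[R]_(nx + 1) * R) :=
  pieces g delta A d a i ++ subpieces g delta A delta i (ngrid g delta i).

Lemma pieces_shift d (i : 'I_N.+1) h a b : (a <= i)%N -> (i < b)%N ->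
  (b <= N.+1)%N -> pieces g delta A (shift d i h) a b =
    pieces_upto_last d a i ++ (A i (ngrid g delta i), h + last_length d i)
      :: pieces g delta A d i.+1 b.
Proof.
move=> ai ib bN; rewrite (pieces_cat _ _ _ _ (leqW ai) ib) piecesS//.
rewrite !pieces_shift_notin ?ltnn ?andbF ?ltnNge ?leqnSn//; last exact: ltnW.
rewrite subpieces_last /pieces_upto_last -cats1 -!catA cat1s.
congr (_ ++ (_ ++ (_, _) :: _)).
by rewrite /last_length !mxE !eqxx mulr1 addrAC addrC.
Qed.

Lemma pieces_lastE d (i : 'I_N.+1) a : (a <= i)%N ->
  pieces g delta A d a i.+1 =
  rcons (pieces_upto_last d a i) (A i (ngrid g delta i), last_length d i).
Proof. by move=> ai; rewrite piecesS// subpieces_last rcons_cat. Qed.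

End Trajectories.

Lemma equigrid_sorted (R : realType) (T : R) M :
  0 < T -> sorted <=%R (equigrid T M).
Proof.
move=> T0; apply: (homo_sorted (e := leq)); last exact: iota_sorted.
by move=> i j ij; rewrite ler_wpM2r ?ler_nat// divr_ge0// ltW.
Qed.

Lemma augment_weight_sym (R : realType) n (M : 'M[R]_n) :
  M^T = M -> (augment_weight M)^T = augment_weight M.
Proof. by move=> MT; rewrite /augment_weight tr_block_mx MT !trmx0. Qed.

(** * Derivatives in the switching intervals *)

Lemma is_partial_derive (R : realType) n (D : set 'rV[R]_n)
    (F : 'rV[R]_n -> R) (d : 'rV[R]_n) (i : 'I_n) (l : R) (phi : R -> R) :
  (forall h, D (d + h *: delta_mx 0 i) -> F (d + h *: delta_mx 0 i) = phi h) ->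
  F d = phi 0 -> is_derive (0 : R) (1 : R) phi l -> is_partial D F d i l.
Proof.
move=> FE Fd [phi1 phi2].
have phil : (fun h : R => h^-1 * (phi h - phi 0)) @ 0^' --> l.
  have E : (fun h : R => h^-1 * (phi h - phi 0)) =
      (fun h => h^-1 *: ((phi \o shift 0) (h *: 1) - phi 0)).
    by apply/funext => h /=; rewrite addr0 [_ *: 1]mulr1.
  by rewrite -phi2 E; exact: phi1.
rewrite /is_partial Fd.
apply: cvg_trans (cvg_trans (cvg_app _ (cvg_within _)) phil).
by apply: near_eq_cvg; rewrite near_withinE; apply: nearW => h /FE ->.
Qed.

Lemma is_derive_qform_mx (R : realType) n (M : R -> 'M[R]_n) (t : R) dM
    (v : 'cV[R]_n) :
  mxderiv M t dM -> is_derive t (1 : R) (fun s => qform (M s) v) (qform dM v).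
Proof.
by move=> hM; exact: (mxderiv_mulr v (mxderiv_mull v^T hM)).
Qed.

Lemma qform_conj (R : realType) m n (M : 'M[R]_m) (B : 'M[R]_(m, n))
    (v : 'cV[R]_n) :
  qform (B^T *m M *m B) v = qform M (B *m v).
Proof. by rewrite /qform trmx_mul !mulmxA. Qed.

Lemma is_derive_qform (R : realType) n (M : 'M[R]_n) (z : R -> 'cV[R]_n)
    (t : R) dz :
  M^T = M -> mxderiv z t dz ->
  is_derive t (1 : R) (fun s => qform M (z s)) (2 * ((z t)^T *m M *m dz) 0 0).
Proof.
move=> MT hz.
have := mxderiv_quad M hz 0 0.
have trE : (dz^T *m M *m z t) 0 0 = ((z t)^T *m M *m dz) 0 0.
  transitivity ((dz^T *m M *m z t)^T 0 0); first by rewrite [RHS]mxE.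
  by rewrite !trmx_mul trmxK MT mulmxA.
by rewrite mxE trE mulr_natl.
Qed.

Section Gradient.
Variables (R : realType) (N nx : nat) (g : seq R) (delta : 'rV[R]_N.+1).
Variable A : nat -> nat -> 'M[R]_(nx + 1).
Variables (Q E : 'M[R]_(nx + 1)).
Implicit Types d : 'rV[R]_N.+1.

Local Notation pieces := (pieces g delta A).
Local Notation An i := (A i (ngrid g delta i)).

(* S_a and C_l as functions of the switching intervals. *)
Definition togo d a := quadcost Q E (pieces d a N.+1).

Definition dtogo d l := Q + (An l)^T *m togo d l.+1 + togo d l.+1 *m An l.

Lemma mxderiv_togo d a (i : 'I_N.+1) : (a <= i)%N ->
  mxderiv (fun h => togo (d + h *: delta_mx 0 i) a) 0
    ((flow (pieces d a i.+1))^T *m dtogo d i *m flow (pieces d a i.+1)).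
Proof.
move=> ai; under [X in mxderiv X]eq_fun do rewrite /togo pieces_shift//.
apply: (@mxderiv_shift0 _ _ _ (fun s => quadcost Q E (_ ++ (_, s) :: _))).
by have := @mxderiv_quadcost _ _ Q E (An i) (pieces_upto_last g delta A d a i)
     (pieces d i.+1 N.+1) (last_length g delta d i); rewrite -pieces_lastE.
Qed.

Lemma mxderiv_flow_pieces d a b (i : 'I_N.+1) : (a <= i)%N -> (i < b)%N ->
  (b <= N.+1)%N ->
  mxderiv (fun h => flow (pieces (d + h *: delta_mx 0 i) a b)) 0
    (flow (pieces d i.+1 b) *m An i *m flow (pieces d a i.+1)).
Proof.
move=> ai ib bN; under [X in mxderiv X]eq_fun do rewrite pieces_shift//.
apply: (@mxderiv_shift0 _ _ _ (fun s => flow (_ ++ (_, s) :: _))).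
by have := @mxderiv_flow _ _ (An i) (pieces_upto_last g delta A d a i)
     (pieces d i.+1 b) (last_length g delta d i); rewrite -pieces_lastE.
Qed.

Definition grad (x0 : 'cV[R]_(nx + 1)) (l : nat) d :=
  qform (dtogo d l) (flow (pieces d 0 l.+1) *m x0).

Lemma is_partial_cost D (J : 'rV[R]_N.+1 -> R) x0 :
  (forall d, D d -> J d = qform (togo d 0) x0) ->
  forall d, D d -> forall l : 'I_N.+1, is_partial D J d l (grad x0 l d).
Proof.
move=> JE d dD l.
apply: (@is_partial_derive _ _ _ _ _ _ _
  (fun h => qform (togo (d + h *: delta_mx 0 l) 0) x0)).
- by move=> h /JE.
- by rewrite scale0r addr0 JE.
- have := is_derive_qform_mx x0 (mxderiv_togo d (leq0n l)).
  by rewrite qform_conj.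
Qed.

Hypotheses (Q_sym : Q^T = Q) (E_sym : E^T = E).

Lemma dtogo_sym d l : (dtogo d l)^T = dtogo d l.
Proof.
rewrite /dtogo !linearD/= !trmx_mul trmxK Q_sym quadcost_sym//.
by rewrite -!addrA [X in _ + X]addrC.
Qed.

Lemma is_partial_grad_le D x0 d (i l : 'I_N.+1) : (i <= l)%N ->
  is_partial D (grad x0 l) d i
    (2 * ((flow (pieces d 0 l.+1) *m x0)^T *m dtogo d l
      *m flow (pieces d i.+1 l.+1) *m An i
      *m (flow (pieces d 0 i.+1) *m x0)) 0 0).
Proof.
move=> il; pose z h := flow (pieces (d + h *: delta_mx 0 i) 0 l.+1) *m x0.
apply: (@is_partial_derive _ _ _ _ _ _ _ (fun h => qform (dtogo d l) (z h))).
- move=> h _; rewrite /grad -/(z h); congr qform.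
  by rewrite /dtogo /togo pieces_shift_notin// ltnNge il.
- by rewrite /z scale0r addr0.
- have dz : mxderiv z 0
      (flow (pieces d i.+1 l.+1) *m An i *m flow (pieces d 0 i.+1) *m x0).
    by apply: mxderiv_mulr; exact: mxderiv_flow_pieces.
  have := is_derive_qform (dtogo_sym d l) dz.
  have -> : z 0 = flow (pieces d 0 l.+1) *m x0 by rewrite /z scale0r addr0.
  by rewrite !mulmxA.
Qed.

Lemma is_partial_grad_gt D x0 d (i l : 'I_N.+1) : (l < i)%N ->
  is_partial D (grad x0 l) d i
    (2 * ((flow (pieces d 0 i.+1) *m x0)^T *m dtogo d i
      *m flow (pieces d l.+1 i.+1) *m An l
      *m (flow (pieces d 0 l.+1) *m x0)) 0 0).
Proof.
move=> li; pose z := flow (pieces d 0 l.+1) *m x0.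
apply: (@is_partial_derive _ _ _ _ _ _ _
  (fun h => qform (dtogo (d + h *: delta_mx 0 i) l) z)).
- by move=> h _; rewrite /grad pieces_shift_notin// leq0n/= ltnS -ltnNge.
- by rewrite scale0r addr0.
- have Vz (P W B : 'M[R]_(nx + 1)) (y : 'cV[R]_(nx + 1)) : W^T = W ->
      qform (P^T *m (B^T *m W *m B) + B^T *m W *m B *m P) y =
      2 * ((B *m y)^T *m W *m B *m P *m y) 0 0.
    move=> WT; rewrite /qform mulmxDr mulmxDl mxE mulr_natl mulr2n.
    rewrite !trmx_mul !mulmxA; congr (_ + _).
    transitivity ((y^T *m P^T *m B^T *m W *m B *m y)^T 0 0).
      by rewrite [RHS]mxE.
    by rewrite !trmx_mul !trmxK WT !mulmxA.
  have zE : flow (pieces d 0 i.+1) *m x0 = flow (pieces d l.+1 i.+1) *m z.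
    by rewrite (pieces_cat _ _ _ _ (leq0n l.+1) (leqW li)) flow_cat -mulmxA.
  rewrite zE -Vz ?dtogo_sym//; apply: is_derive_qform_mx.
  have dV := mxderiv_togo d li.
  under [X in mxderiv X]eq_fun do rewrite /dtogo -addrA.
  exact/mxderiv_addl/mxderivD/mxderiv_mulr/dV/mxderiv_mull.
Qed.

End Gradient.

Theorem theorem1 (R : realType) (nx N M : nat) (T : R)
    (f : 'I_N.+1 -> 'cV[R]_nx -> 'cV[R]_nx)
    (Qbar Ebar : 'M[R]_nx) (xinit : 'cV[R]_nx)
    (delta : 'rV[R]_N.+1) (X : 'rV[R]_N.+1 -> R -> 'cV[R]_(nx + 1)) :
  (0 < M)%N -> 0 < T ->
  (forall i p, differentiable (f i) p) ->
  sym_psd Qbar -> sym_psd Ebar ->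
  (forall i, 0 <= delta 0 i) ->
  let g := equigrid T M in
  let Q := augment_weight Qbar in
  let E := augment_weight Ebar in
  let x0 := augment xinit in
  let A := modes g f delta (X delta) in
  let D := admissible g delta in
  (forall d, D d -> is_trajectory g A delta d x0 (X d)) ->
  let J := fun d => cost Q E d (X d) in
  let S := Smx g A delta Q E in
  let C := Cmx g A delta Q E in
  let n := ngrid g delta in
  let x := fun i : nat => X delta (tau delta i) in
  let H := fun i l : 'I_N.+1 =>
    2 * ((x l.+1)^T *m C l *m Phi_sw g A delta l.+1 i.+1
           *m A i (n i) *m x i.+1) 0 0 in
  [/\ J delta = qform (S 0%N) x0,
      forall i : 'I_N.+1, is_partial D J delta i (qform (C i) (x i.+1)) &
      forall i l : 'I_N.+1,
        is_partial2 D J delta i l (if (i <= l)%N then H i l else H l i)].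
Proof.
move=> _ T0 _ [QT _] [ET _] delta0 g Q E x0 A D XT J S C n x H.
have gs : sorted <=%R g by exact: equigrid_sorted.
have Dd : D delta by exact: admissible_id.
have QS : Q^T = Q by exact: augment_weight_sym.
have ES : E^T = E by exact: augment_weight_sym.
have JE d : D d -> J d = qform (togo g delta A Q E d 0) x0.
  by move=> dD; exact: (cost_quadcost gs delta0 Q E dD (XT d dD)).
have SE i : (i <= N.+1)%N -> S i = togo g delta A Q E delta i.
  exact: SmxE.
have CE (i : 'I_N.+1) : C i = dtogo g delta A Q E delta i.
  by rewrite /C /Cmx -/S SE.
have xE (i : 'I_N.+1) : x i.+1 = flow (pieces g delta A delta 0 i.+1) *m x0.
  exact: trajectory_tau (XT _ Dd) _.
have dJ d (l : 'I_N.+1) : D d -> is_partial D J d l (grad g delta A Q E x0 l d).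
  by move=> dD; exact: is_partial_cost.
split=> [|i|i l].
- by rewrite JE// SE.
- by rewrite CE xE; exact: dJ.
- exists (grad g delta A Q E x0 l); first by move=> d dD; exact: dJ.
  case: leqP => [il|li]; rewrite /H CE !xE Phi_swE ?ltnS//; last exact: ltnW.
    exact: is_partial_grad_le.
  exact: is_partial_grad_gt.
Qed.
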